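(* Let $\eta > 50$ be independent of $n$, and $p = \frac{\eta \log n}{n-1}$. Consider the lazy simple random walk on a sequence $(G_t)_{t\in\mathbb{Z}}$ of independent Erdős–Rényi graphs on $[n]=\{1,\dots,n\}$ with edge probability $p$, with quenched mixing time $t_{\mathrm{mix}}(\varepsilon,0)$. Let $\varepsilon \in (0, 1/2)$. Then there exists a constant $c > 0$ such that $$t_\mathrm{mix}(\varepsilon,0) \geq c \frac{\log n}{\log\log n}$$ with high probability, i.e. $\lim_{n\to\infty}\mathbf{P}\big(t_\mathrm{mix}(\varepsilon,0) \geq c \frac{\log n}{\log\log n}\big)=1$.
   Context: For each $n$ (large enough that $p\in(0,1)$), $(G_t)_{t\in\mathbb{Z}}$ are i.i.d. Erdős–Rényi random graphs on vertex set $[n]$, in which each pair of distinct vertices is joined by an edge independently with probability $p$. Write $\deg_t(x)$ for the degree of $x$ in $G_t$ and $x\sim_t y$ if $x,y$ are adjacent in $G_t$. The transition matrix $P_t$ is: $P_t(x,x)=1/2$ if $\deg_t(x)\ge 1$; $P_t(x,x)=1$ if $\deg_t(x)=0$; $P_t(x,y)=1/(2\deg_t(x))$ if $x\ne y$ and $x\sim_t y$; and $P_t(x,y)=0$ otherwise. $\mathbf{P}$ denotes the law of the random sequence $(P_s)_{s\in\mathbb{Z}}$ (for given $n$). For $s<t$ put $P^{s,t}=P_{s+1}\cdots P_t$ and let $P^{s,s}$ be the identity matrix. For $\mathbf{P}$-almost every sequence, for every $t\in\mathbb{Z}$ the limit $\pi_t(y)=\lim_{s\to-\infty}P^{s,t}(x,y)$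 exists for all $x,y\in[n]$ and does not depend on $x$; $\pi_t$ is a probability distribution on $[n]$. For such a sequence let $d(0,t)=\sup_{x\in[n]}\|P^{0,t}(x,\cdot)-\pi_t(\cdot)\|_{\mathrm{TV}}$, where $\|\mu-\nu\|_{\mathrm{TV}}=\frac12\sum_x|\mu(x)-\nu(x)|$, and $t_{\mathrm{mix}}(\varepsilon,0)=\inf\{t\ge 0: d(0,t)\le\varepsilon\}$ (over integers $t$). *)

(* Defs.v *)
From HB Require Import structures.
From mathcomp Require Import all_boot all_order all_algebra.
From mathcomp Require Import all_classical all_reals all_analysis.

Set Implicit Arguments.
Unset Strict Implicit.
Unset Printing Implicit Defensive.

Import Order.TTheory GRing.Theory Num.Theory.
Import numFieldNormedType.Exports.

Local Open Scope classical_set_scope.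
Local Open Scope ring_scope.

(* The set [n] is 'I_n; a simple graph is a set of unordered pairs (the
   2-element subsets) of vertices. *)
Definition vertex_pairs (n : nat) : {set {set 'I_n}} :=
  [set e : {set 'I_n} | #|e| == 2%N]%SET.

Definition graph (n : nat) : Type :=
  {E : {set {set 'I_n}} | E \subset vertex_pairs n}.

(* For x = y, [set x; y] is a singleton, so adjacency is irreflexive. *)
Definition adj (n : nat) (g : graph n) (x y : 'I_n) : bool :=
  [set x; y]%SET \in val g.

Definition deg (n : nat) (g : graph n) (x : 'I_n) : nat :=
  #|[set y : 'I_n | adj g x y]%SET|.

Section Independence.
Context (d : measure_display) (T : measurableType d) (R : realType).
Variable P : probability T R.

Definition independent_events (I : eqType) (D : set I) (A : I -> set T) : Prop :=
  (forall i, D i -> measurable (A i)) /\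
  forall J : seq I, uniq J -> {in J, forall i, D i} ->
    P (\bigcap_(i in [set` J]) A i) = (\prod_(i <- J) P (A i))%E.

(* Random variables with values in a type with finitely many elements, all of
   whose subsets are measurable. *)
Definition discrete_rv (S : Type) (X : T -> S) : Prop :=
  forall B : set S, measurable (X @^-1` B).

Definition independent_rvs (I : eqType) (S : Type) (X : I -> T -> S) : Prop :=
  (forall i, discrete_rv (X i)) /\
  forall B : I -> set S, independent_events setT (fun i => X i @^-1` B i).

Definition erdos_renyi (n : nat) (p : R) (g : T -> graph n) : Prop :=
  [/\ discrete_rv g,
      (forall e, e \in vertex_pairs n -> P [set w | e \in val (g w)] = p%:E)
    & independent_events [set` vertex_pairs n] (fun e => [set w | e \in val (g w)])].

Definition iid_erdos_renyi (n : nat) (p : R) (G : int -> T -> graph n) : Prop :=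
  (forall t, erdos_renyi p (G t)) /\ independent_rvs G.

End Independence.

Section LazyWalk.
Context (R : realType) (n : nat).

Definition lazy_walk (g : graph n) : 'M[R]_n :=
  \matrix_(x, y)
    (if x == y then (if deg g x == 0%N then 1 else 2^-1)
     else if adj g x y then (2 * (deg g x)%:R)^-1 else 0).

Variable g : int -> graph n.

(* P^{s,t} = P_{s+1} ... P_t, used only for s <= t. *)
Definition transition (s t : int) : 'M[R]_n :=
  \big[mulmx/1%:M]_(0 <= i < `|t - s|%N) lazy_walk (g (s + 1 + i%:Z)).

Definition tv_dist (mu nu : 'rV[R]_n) : R :=
  2^-1 * \sum_x `|mu 0 x - nu 0 x|.

Definition is_pi (t : int) (mu : 'rV[R]_n) : Prop :=
  forall x y, transition (t - k%:Z) t x y @[k --> \oo] --> mu 0 y.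

Definition has_pi : Prop := forall t, exists mu, is_pi t mu.

(* Meaningful only under [has_pi]; the limit is then unique when n > 0. *)
Definition pi_ (t : int) : 'rV[R]_n := xget 0 (is_pi t).

Definition mix_dist (s t : int) : R :=
  \big[Num.max/0]_(x < n) tv_dist (row x (transition s t)) (pi_ t).

(* t_mix(eps, 0), equal to +oo if the distance never drops to eps. *)
Definition tmix0 (eps : R) : \bar R :=
  ereal_inf [set (t%:R)%:E | t in [set t : nat | mix_dist 0 t%:Z <= eps]].

End LazyWalk.

Definition edge_prob (R : realType) (eta : R) (n : nat) : R :=
  eta * ln n%:R / (n%:R - 1).

(* Main.v *)
Require Import Defs.
From HB Require Import structures.
From mathcomp Require Import all_boot all_order all_algebra.
From mathcomp Require Import all_classical all_reals all_analysis.
From mathcomp Require Import measurable_realfun zify lra.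

(** Call a vertex [y] reachable from [x] if [P^{0,t}(x,y) <> 0].  If all degrees
in [G_1, ..., G_t] are below [K], then forward and backward reachable sets have
at most [K^t] elements.  As soon as [K^(2t) < n] two starting points thus have
disjoint reachable sets; their laws at time [t] are at distance 1, so one of
them is at distance at least 1/2 > eps from [pi_t], whatever [pi_t] is.  A
Chernoff bound gives [K = O(log n)] simultaneously for all vertices and all times
up to [n] with probability at least [1 - 1/n], and then [K^(2t) < n] holds for
[t < (1/4) log n / log log n].

The limits [pi_t] exist almost surely because complete graphs occur infinitely
often in the past, and each of them halves the oscillation of the columns of
[P^{s,t}]. *)

Set Implicit Arguments.
Unset Strict Implicit.
Unset Printing Implicit Defensive.

Import Order.TTheory GRing.Theory Num.Theory.
Import numFieldNormedType.Exports.

Local Open Scope classical_set_scope.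
Local Open Scope ring_scope.

(** * Row-stochastic matrices and products of lazy walk matrices *)

Section StochasticMatrices.
Context (R : realType) (n : nat).
Implicit Types (M N W : 'M[R]_n) (g : graph n) (x y : 'I_n).

Definition stochastic M : Prop :=
  (forall x y, 0 <= M x y) /\ forall x, \sum_y M x y = 1.

Lemma stochastic1 : stochastic 1%:M.
Proof.
split=> [x y|x]; first by rewrite mxE ler0n.
rewrite (bigD1 x)//= big1 ?addr0 => [|y /negPf yx]; first by rewrite mxE eqxx.
by rewrite mxE eq_sym yx.
Qed.

Lemma stochasticM M N : stochastic M -> stochastic N -> stochastic (M *m N).
Proof.
move=> [M0 M1] [N0 N1]; split=> [x y|x].
  by rewrite mxE sumr_ge0// => z _; rewrite mulr_ge0.
under eq_bigr do rewrite mxE.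
rewrite exchange_big/= -[RHS](M1 x); apply: eq_bigr => z _.
by rewrite -mulr_sumr N1 mulr1.
Qed.

Lemma adj_sym g x y : adj g x y = adj g y x.
Proof. by rewrite /adj finset.setUC. Qed.

Lemma adj_irr g x : adj g x x = false.
Proof.
apply/negbTE/negP => xx; have /fintype.subsetP/(_ _ xx) := valP g.
by rewrite !inE finset.setUid cards1.
Qed.

Lemma lazy_walk_stochastic g : stochastic (lazy_walk R g).
Proof.
split=> [x y|x].
  by rewrite mxE; do 2?case: ifP => // _; rewrite invr_ge0 ?mulr_ge0// ?ler0n.
rewrite (bigD1 x)//= mxE eqxx.
under eq_bigr => y /negPf yx do rewrite mxE eq_sym yx.
have -> : \sum_(y | y != x) (if adj g x y then (2 * (deg g x)%:R)^-1 else 0 : R)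
   = \sum_(y in [set y | adj g x y]%SET) (2 * (deg g x)%:R)^-1.
  rewrite -big_mkcondr/=; apply: eq_bigl => y; rewrite inE.
  by case: eqP => //= ->; rewrite adj_irr.
rewrite sumr_const -/(deg g x) -[_ *+ deg g x]mulr_natr.
(* At an isolated vertex the diagonal carries all the mass; otherwise the [deg g x] neighbours share
   exactly one half. *)
have [->|d0] := eqVneq (deg g x) 0%N; first by rewrite mulr0 addr0.
have /negPf d0' : (deg g x)%:R != 0 :> R by rewrite pnatr_eq0.
by rewrite invfM -mulrA mulVf ?d0'//; lra.
Qed.

Context (G : int -> graph n).

Lemma transitionxx (s : int) : transition R G s s = 1%:M.
Proof. by rewrite /transition subrr big_geq. Qed.

(** Products grow on the left because the limits [s -> -oo] reach into the past; all later
    inductions run in this direction. *)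
Lemma transition_step (s t : int) : s <= t ->
  transition R G (s - 1) t = lazy_walk R (G s) *m transition R G s t.
Proof.
move=> st; have : `|(t - s)%R|%N%:Z = t - s by rewrite gez0_abs ?subr_ge0.
rewrite /transition; set k := `|_|%N => kE.
have -> : `|(t - (s - 1))%R|%N = k.+1.
  by apply/eqP; rewrite -eqz_nat gez0_abs ?intS ?kE; [apply/eqP|]; lia.
rewrite big_ltn// big_add1/= !addr0 subrK; congr (_ *m _).
by apply: eq_bigr => i _; congr (lazy_walk R (G _)); rewrite intS; lia.
Qed.

Lemma transition_stepn t k :
  transition R G (t - k.+1%:Z) t
  = lazy_walk R (G (t - k%:Z)) *m transition R G (t - k%:Z) t.
Proof. by rewrite -transition_step; [congr transition; rewrite intS; lia|lia]. Qed.

Lemma transition_stochastic t k : stochastic (transition R G (t - k%:Z) t).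
Proof.
elim: k => [|k IH]; first by rewrite subr0 transitionxx; exact: stochastic1.
by rewrite transition_stepn; apply: stochasticM => //; exact: lazy_walk_stochastic.
Qed.

(** * Supports of rows, and of columns through transposes *)

Definition sparse (a : nat) M : Prop :=
  forall x, (#|[set y | M x y != 0%R]%SET| <= a)%N.

Lemma card_bigcup_sparse a b N (S : {set 'I_n}) : (#|S| <= a)%N -> sparse b N ->
  (#|\bigcup_(z in S) [set y | N z y != 0%R]%SET|%SET <= a * b)%N.
Proof.
move=> Sa Nb; apply: (@leq_trans (\sum_(z in S) b)%N).
  apply: (big_rec2 (fun A k => (#|A : {set 'I_n}| <= k)%N)) => [|z k A _ Ak].
    by rewrite cards0.
  exact: (leq_trans (leq_card_setU _ _) (leq_add (Nb z) Ak)).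
by rewrite sum_nat_const leq_mul2r Sa orbT.
Qed.

(** A nonzero entry of the product needs an intermediate [z] with both factors nonzero. *)
Lemma sparseM a b M N : sparse a M -> sparse b N -> sparse (a * b) (M *m N).
Proof.
move=> Ma Nb x.
have sub : [set y | (M *m N) x y != 0%R]%SET
    \subset (\bigcup_(z in [set z | M x z != 0%R]) [set y | N z y != 0%R])%SET.
  apply/fintype.subsetP => y; rewrite inE mxE => /eqP nz.
  have [z /andP[Mz Nz]|no] := pickP (fun z => (M x z != 0) && (N z y != 0)).
    by apply/bigcupP; exists z; rewrite inE.
  case: nz; apply: big1 => z _; move: (no z) => /negbT.
  by rewrite negb_and !negbK => /orP[] /eqP ->; rewrite ?mul0r ?mulr0.
exact: leq_trans (subset_leq_card sub) (card_bigcup_sparse (Ma x) Nb).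
Qed.

Lemma sparse1 : sparse 1 1%:M.
Proof.
move=> x; rewrite -(cards1 x); apply/subset_leq_card/fintype.subsetP => y.
by rewrite !inE mxE (eq_sym x); case: (y == x); rewrite ?eqxx.
Qed.

(** The strict inequality leaves room for the holding step at [x] itself; columns follow by symmetry
    of adjacency. *)
Lemma lazy_walk_sparse g K : (forall x, (deg g x < K)%N) ->
  sparse K (lazy_walk R g) /\ sparse K (lazy_walk R g)^T.
Proof.
move=> degK.
have supp x y : (lazy_walk R g) x y != 0 -> y \in (x |: [set z | adj g x z])%SET.
  by rewrite mxE !inE (eq_sym y); case: (x == y) => //=; case: ifP => //; rewrite eqxx.
have card x : (#|(x |: [set z | adj g x z])%SET| <= K)%N.
  by apply: leq_trans (degK x); rewrite cardsU1 -add1n leq_add ?leq_b1.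
split=> x; apply: leq_trans (card x); apply/subset_leq_card/fintype.subsetP => y.
  by rewrite inE; exact: supp.
by rewrite inE mxE => /supp; rewrite !inE eq_sym adj_sym.
Qed.

Lemma transition_sparse t k K :
  (forall i x, (i < k)%N -> (deg (G (t - i%:Z)) x < K)%N) ->
  sparse (K ^ k) (transition R G (t - k%:Z) t) /\
  sparse (K ^ k) (transition R G (t - k%:Z) t)^T.
Proof.
elim: k => [|k IH] degK.
  by rewrite subr0 transitionxx trmx1; split; exact: sparse1.
have [IHr IHc] := IH (fun i x ik => degK i x (ltnW ik)).
have [Wr Wc] := lazy_walk_sparse (fun x => degK k x (ltnSn k)).
rewrite transition_stepn trmx_mul; split; first by rewrite expnS; exact: sparseM.
by rewrite expnSr; exact: sparseM.
Qed.

(** From [x] go forward to at most [a] endpoints, and from each back to at most [a] starting points.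
    These at most [a * a] starting points form [B], and any vertex outside [B] will do. *)
Lemma exists_disjoint_rows a M x : sparse a M -> sparse a M^T -> (a * a < n)%N ->
  exists x', forall y, M x y = 0 \/ M x' y = 0.
Proof.
move=> Mr Mc an; pose B := (\bigcup_(y in [set y | M x y != 0%R]) [set x' | M^T y x' != 0%R])%SET.
have Ba : (#|B| <= a * a)%N := card_bigcup_sparse (Mr x) Mc.
have [x' x'B] : exists x', x' \notin B.
  apply/existsP; rewrite -negb_forall; apply/negP => /forallP allB.
  have : (#|'I_n| <= #|B|)%N by apply/subset_leq_card/fintype.subsetP => z _; exact: allB.
  by rewrite card_ord leqNgt (leq_ltn_trans Ba).
exists x' => y; have [|Mxy] := eqVneq (M x y) 0; first by left.
right; apply/eqP/negPn/negP => Mx'y; case/bigcupP: x'B; exists y; rewrite inE//.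
by rewrite mxE.
Qed.

(** * Total variation and the lower bound on the mixing distance *)

Lemma tv_dist_triangle (mu nu pi : 'rV[R]_n) :
  tv_dist mu nu <= tv_dist mu pi + tv_dist nu pi.
Proof.
rewrite /tv_dist -mulrDr ler_pM2l ?invr_gt0// -big_split/=.
apply: ler_sum => x _; rewrite [X in _ <= _ + X]distrC.
by rewrite (le_trans _ (ler_normD _ _))// addrA subrK.
Qed.

(** With disjoint supports [|a - b| = a + b] in every coordinate, so the sum of differences is 2. *)
Lemma tv_dist_disjoint_rows M x x' : stochastic M ->
  (forall y, M x y = 0 \/ M x' y = 0) -> tv_dist (row x M) (row x' M) = 1.
Proof.
move=> [M0 M1] disj; rewrite /tv_dist.
under eq_bigr => y _.
  have -> : `|row x M 0 y - row x' M 0 y| = M x y + M x' y.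
    rewrite !mxE; case: (disj y) => ->; first by rewrite sub0r normrN ger0_norm ?add0r.
    by rewrite subr0 addr0 ger0_norm.
  over.
by rewrite big_split/= !M1 mulVf.
Qed.

Lemma mix_dist_ge s t x :
  tv_dist (row x (transition R G s t)) (pi_ R G t) <= mix_dist R G s t.
Proof. exact: (le_bigmax _ (fun x => tv_dist (row x (transition R G s t)) _)). Qed.

Lemma mix_dist_ge_half K k : (forall i x, (0 < i <= k)%N -> (deg (G i%:Z) x < K)%N) ->
  (K ^ k * K ^ k < n)%N -> 2^-1 <= mix_dist R G 0 k%:Z.
Proof.
move=> degK Kn; have n0 : (0 < n)%N by exact: leq_ltn_trans Kn.
have t0 : k%:Z - k%:Z = 0 by rewrite subrr.
(* Counting back from time [k], the graphs used are those at times 1 to [k]; the graph at time 0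
   does not enter. *)
have degK' i x : (i < k)%N -> (deg (G (k%:Z - i%:Z)) x < K)%N.
  by move=> ik; rewrite subzn ?(ltnW ik)//; apply: degK; rewrite subn_gt0 ik leq_subr.
have [Mr Mc] := transition_sparse degK'; have Ms := transition_stochastic k%:Z k.
rewrite t0 in Mr Mc Ms; pose x := Ordinal n0.
have [x' disj] := exists_disjoint_rows x Mr Mc Kn.
have := tv_dist_triangle (row x (transition R G 0 k%:Z)) (row x' (transition R G 0 k%:Z)) (pi_ R G k%:Z).
rewrite tv_dist_disjoint_rows//.
by have := mix_dist_ge 0 k%:Z x; have := mix_dist_ge 0 k%:Z x'; lra.
Qed.

(* Left multiplication by a row-stochastic matrix averages the rows, so it
   preserves [confined l r]; for the walk on the complete graph it also halves
   the width [r]. *)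
Definition confined (l : 'I_n -> R) (r : R) M : Prop :=
  forall x y, l y <= M x y <= l y + r.

Lemma confinedM l r M N : stochastic M -> confined l r N -> confined l r (M *m N).
Proof.
move=> [M0 M1] Nlr x y; rewrite mxE.
have E c : c = \sum_z M x z * c by rewrite -mulr_suml M1 mul1r.
by apply/andP; split; [rewrite [X in X <= _]E|rewrite [X in _ <= X]E];
  apply: ler_sum => z _; rewrite ler_wpM2l//; have /andP[] := Nlr z y.
Qed.

(** * Complete graphs and coalescence of the rows *)

Definition complete g : Prop := val g = vertex_pairs n.

Lemma complete_adj g x y : complete g -> adj g x y = (x != y).
Proof. by rewrite /adj => ->; rewrite inE cards2; case: (x != y). Qed.

(** A Doeblin minorization: one step dominates half of the uniform law, whatever the starting
    point. *)
Lemma complete_lazy_walk g x y : complete g -> (2 * n%:R)^-1 <= lazy_walk R g x y.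
Proof.
move=> gc; have n0 : (0 < n)%N by case: n x => [[]|].
have n0' : 0 < n%:R :> R by rewrite ltr0n.
have degx : deg g x = n.-1.
  rewrite /deg (_ : [set y | adj g x y]%SET = [set~ x]%SET) ?cardsC1 ?card_ord//.
  by apply/setP => z; rewrite !inE complete_adj// eq_sym.
rewrite mxE degx complete_adj//; case: eqVneq => [_|xy].
  have n1 : 1 <= n%:R :> R by rewrite ler1n.
  case: ifP => _; first by rewrite invf_le1 ?mulr_gt0//; lra.
  by rewrite lef_pV2 ?posrE ?mulr_gt0//; lra.
have n1 : (1 < n)%N.
  by case: n x y xy {gc n0 n0' degx} => [[]//|[|//]] x y; rewrite (ord1 x) (ord1 y) eqxx.
by rewrite lef_pV2 ?posrE ?mulr_gt0 ?ltr0n ?ler_pM2l ?ler_nat//; lia.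
Qed.

(** Subtracting [a] from each weight splits off a term common to all rows; the remaining nonnegative
    weights sum to one half, which halves the width. *)
Lemma complete_confinedM l r g M : complete g -> confined l r M ->
  exists l', confined l' (r / 2) (lazy_walk R g *m M).
Proof.
move=> gc Mlr; pose a : R := (2 * n%:R)^-1.
have [W0 W1] := lazy_walk_stochastic g.
exists (fun y => a * (\sum_z M z y) + 2^-1 * l y) => x y.
have n0 : n%:R != 0 :> R by rewrite pnatr_eq0; case: n x => [[]|].
have E : (lazy_walk R g *m M) x y =
    a * (\sum_z M z y) + \sum_z (lazy_walk R g x z - a) * M z y.
  by rewrite mxE mulr_sumr -big_split/=; apply: eq_bigr => z _; rewrite mulrBl subrKC.
have E2 c : 2^-1 * c = \sum_z (lazy_walk R g x z - a) * c.
  rewrite -mulr_suml sumrB W1 sumr_const card_ord -[a *+ n]mulr_natr /a invfM mulfVK//.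
  by congr (_ * _); lra.
rewrite E -addrA !lerD2l (_ : _ + r / 2 = 2^-1 * (l y + r)); last by lra.
by rewrite !E2; apply/andP; split; apply: ler_sum => z _;
  rewrite ler_wpM2l ?subr_ge0 ?complete_lazy_walk//; have /andP[] := Mlr z y.
Qed.

Lemma transition_confined_le l r t k k' : (k <= k')%N ->
  confined l r (transition R G (t - k%:Z) t) ->
  confined l r (transition R G (t - k'%:Z) t).
Proof.
move=> /subnK <- Mlr; elim: (k' - k)%N => // m IH.
by rewrite addSn transition_stepn; apply: confinedM => //; exact: lazy_walk_stochastic.
Qed.

(* Cauchy criterion for [has_pi] at time [t]; this is the form in which the
   event is seen to be measurable. *)
Definition coalescing (t : int) : Prop := forall j, exists k, forall k', (k <= k')%N ->
  forall x x' y, `|transition R G (t - k%:Z) t x y - transition R G (t - k'%:Z) t x' y|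
     <= 2^-1 ^+ j.

Lemma complete_often_coalescing t :
  (forall m : nat, exists2 k, (m <= k)%N & complete (G (- k%:Z))) -> coalescing t.
Proof.
move=> often.
have conf j : exists k l, confined l (2^-1 ^+ j) (transition R G (t - k%:Z) t).
  elim: j => [|j [k [l IH]]].
    exists 0%N, (fun _ => 0) => x y.
    rewrite subr0 transitionxx mxE ler0n add0r expr0.
    by case: (x == y); rewrite ?ler01 ?lexx.
  (* Adding the absolute value of [t] makes [- m <= t - k], so this complete graph lies to the left
     of the product already controlled. *)
  have [m km Gm] := often (k + `|t%R|)%N.
  have [k' [kk' k'E]] : exists k' : nat, (k <= k')%N /\ t - k'%:Z = - m%:Z.
    by exists `|(t + m%:Z)%R|%N; split; lia.
  have := transition_confined_le kk' IH; rewrite -k'E in Gm.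
  move=> /(complete_confinedM Gm)[l' ?]; exists k'.+1, l'.
  by rewrite transition_stepn exprSr.
move=> j; have [k [l kl]] := conf j; exists k => k' kk' x x' y.
have := transition_confined_le kk' kl x' y; have := kl x y.
by move=> /andP[? ?] /andP[? ?]; rewrite ler_norml; apply/andP; split; lra.
Qed.

End StochasticMatrices.

(** * Existence of the limits, and the mixing time as an infimum *)

Section PiExistence.
Context (R : realType) (n : nat) (G : int -> graph n).

(** Forward, finitely many entries converge uniformly, to limits common to all rows. Backward, the
    case [x = x'] makes each entry Cauchy, and comparing different rows forces equal limits. *)
Lemma has_pi_coalescing : (0 < n)%N -> has_pi R G <-> forall t, coalescing R G t.
Proof.
move=> n0; split=> [pi t j|coal t].
  have [mu mut] := pi t.
  have e0 : 0 < (2^-1 ^+ j) / 2 :> R by rewrite divr_gt0// exprn_gt0// invr_gt0.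
  have [N _ HN] : \forall k \near \oo, forall x, forall y,
      `|mu 0 y - transition R G (t - k%:Z) t x y| <= (2^-1 ^+ j) / 2.
    apply: filter_forall => x; apply: filter_forall => y.
    by have /cvgrPdist_le := mut x y; apply.
  exists N => k' Nk' x x' y.
  have := HN N (leqnn N) x y; have := HN k' Nk' x' y.
  by rewrite !ler_norml => /andP[? ?] /andP[? ?]; apply/andP; split; lra.
have cvgM x y : cvgn (fun k : nat => transition R G (t - k%:Z) t x y).
  apply/cauchy_cvgP/cauchy_ballP/cauchy_ballP/cauchy_exP => e e0.
  have [j je] : exists j, 2^-1 ^+ j < e :> R.
    have /cvgrPdist_lt/(_ e e0)[N _ /(_ N (leqnn N))] :
        (fun j => 2^-1 ^+ j : R) @ \oo --> (0 : R).
      by apply: cvg_expr; rewrite ger0_norm//; lra.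
    by rewrite sub0r normrN ger0_norm ?exprn_ge0// => ?; exists N.
  have [k Hk] := coal t j; exists (transition R G (t - k%:Z) t x y).
  by exists k => // k' kk'; apply: le_lt_trans je; exact: Hk.
pose x0 := Ordinal n0.
exists (\row_y limn (fun k : nat => transition R G (t - k%:Z) t x0 y)) => x y.
rewrite mxE; apply/cvgrPdist_lt => e e0.
have e20 : 0 < e / 2 by rewrite divr_gt0.
(* Rows [x] and [x0] at [k'] are each within [e / 4] of row [x] at [k]; the other [e / 2] pays for
   convergence of row [x0]. *)
have [j je] : exists j, 2^-1 ^+ j < e / 4 :> R.
  have e40 : 0 < e / 4 by rewrite divr_gt0.
  have /cvgrPdist_lt/(_ _ e40)[N _ /(_ N (leqnn N))] :
      (fun j => 2^-1 ^+ j : R) @ \oo --> (0 : R).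
    by apply: cvg_expr; rewrite ger0_norm//; lra.
  by rewrite sub0r normrN ger0_norm ?exprn_ge0// => ?; exists N.
have [k Hk] := coal t j.
have /cvgrPdist_lt/(_ _ e20) H0 := cvgM x0 y.
near=> k'.
have kk' : (k <= k')%N by near: k'; exact: nbhs_infty_ge.
have h0 : `|limn (fun k : nat => transition R G (t - k%:Z) t x0 y)
            - transition R G (t - k'%:Z) t x0 y| < e / 2 by near: k'.
have := Hk k' kk' x x0 y; have := Hk k' kk' x x y.
move: h0; rewrite !ler_norml !ltr_norml => /andP[? ?] /andP[? ?] /andP[? ?].
by apply/andP; split; lra.
Unshelve. all: by end_near.
Qed.

(** Replaces the extended-real infimum by countably many strict inequalities; the value [+oo] of an
    empty infimum is covered too. *)
Lemma tmix0_geP (c eps : R) : (c%:E <= tmix0 G eps)%E <->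
  forall t : nat, t%:R < c -> eps < mix_dist R G 0 t%:Z.
Proof.
split=> [ct t tc|H].
  rewrite ltNge; apply/negP => le_eps.
  have : (tmix0 G eps <= t%:R%:E)%E by apply: ereal_inf_lbound; exists t.
  by move=> /(le_trans ct); rewrite lee_fin leNgt tc.
apply/ereal_infP => _ [t /= le_eps <-]; rewrite lee_fin leNgt.
by apply/negP => /H; rewrite ltNge le_eps.
Qed.

End PiExistence.

(** * Measurability of the event *)

Section Measurability.
Context d (T : measurableType d) (R : realType).

Lemma measurable_exists (I : countType) (Q : I -> T -> Prop) :
  (forall i, measurable [set w | Q i w]) -> measurable [set w | exists i, Q i w].
Proof.
move=> mQ; rewrite (_ : [set w | _] = \bigcup_i [set w | Q i w]).
  by apply: countable_bigcupT_measurable => //; exact: countableP.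
by apply/seteqP; split=> w /= [i]; [exists i|exists i].
Qed.

Lemma measurable_forall (I : countType) (Q : I -> T -> Prop) :
  (forall i, measurable [set w | Q i w]) -> measurable [set w | forall i, Q i w].
Proof.
move=> mQ; rewrite -[X in measurable X]setCK; apply: measurableC.
rewrite (_ : ~` _ = [set w | exists i, ~ Q i w]).
  by apply: measurable_exists => i; exact: measurableC (mQ i).
by apply/seteqP; split=> w /=; rewrite existsNP.
Qed.

Lemma measurable_imply (P : Prop) (Q : T -> Prop) :
  (P -> measurable [set w | Q w]) -> measurable [set w | P -> Q w].
Proof.
have [HP /(_ HP)|nP _] := pselect P.
  by congr measurable; apply/seteqP; split=> w //= /(_ HP).
by rewrite (_ : [set w | _] = setT)//; apply/seteqP; split=> // w _ /nP.
Qed.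

Context (n : nat) (G : int -> T -> graph n) (mG : forall t, discrete_rv (G t)).

Lemma measurable_transition s t x y :
  measurable_fun setT (fun w => transition R (G ^~ w) s t x y).
Proof.
rewrite /transition; elim: (index_iota _ _) x y => [|i r IH] x y.
  by under eq_fun do rewrite big_nil; exact: measurable_cst.
under eq_fun do rewrite big_cons mxE.
apply: measurable_sum => z; apply: measurable_funM => //.
by move=> _ B _; rewrite setTI; exact: (mG _ [set g | B (lazy_walk R g x z)]).
Qed.

Lemma measurable_has_pi : (0 < n)%N -> measurable [set w | has_pi R (G ^~ w)].
Proof.
move=> n0; rewrite (_ : [set w | _] = [set w | forall t, coalescing R (G ^~ w) t]); last first.
  by apply/seteqP; split=> w /has_pi_coalescing; exact.
apply: measurable_forall => t; apply: measurable_forall => j.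
apply: measurable_exists => k; apply: measurable_forall => k'.
apply: measurable_imply => _; do 3!apply: measurable_forall => ?.
rewrite -[X in measurable X]setTI; apply: measurable_fun_le => //.
by apply: measurableT_comp => //; apply: measurable_funB; exact: measurable_transition.
Qed.

Lemma measurable_mix_dist s t :
  measurable_fun [set w | has_pi R (G ^~ w)] (fun w => mix_dist R (G ^~ w) s t).
Proof.
rewrite /mix_dist.
have bigmax (r : seq 'I_n) (D : set T) (h : 'I_n -> T -> R) : (forall x, measurable_fun D (h x)) ->
    measurable_fun D (fun w => \big[Num.max/0]_(x <- r) h x w).
  move=> mh; elim: r => [|x r IH].
    by under eq_fun do rewrite big_nil; exact: measurable_cst.
  by under eq_fun do rewrite big_cons; exact: measurable_maxr.
apply: bigmax => x; rewrite /tv_dist; apply: measurable_funM => //.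
apply: measurable_sum => y; apply: measurableT_comp => //; apply: measurable_funB.
  rewrite [X in measurable_fun _ X](_ : _ = fun w => transition R (G ^~ w) s t x y).
    exact: measurable_funTS (measurable_transition s t x y).
  by apply/funext => w; rewrite mxE.
(* On the domain [has_pi], the [y] entry of [pi_] is a pointwise limit of entries along any row; row
   [y] is an arbitrary choice. *)
apply: (@measurable_fun_cvg _ _ _ _ (fun k w => transition R (G ^~ w) (t - k%:Z) t y y)).
  by move=> k; exact: measurable_funTS (measurable_transition _ _ _ _).
by move=> w pi; exact: (xgetPex 0 (pi t)).
Qed.

(* A [probability] is only meaningful on measurable sets, so the event of the
   theorem has to be shown measurable before it can be estimated. *)
Lemma measurable_event (c eps : R) : (0 < n)%N ->
  measurable [set w | has_pi R (G ^~ w) /\ (c%:E <= tmix0 (G ^~ w) eps)%E].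
Proof.
move=> n0; have mH := measurable_has_pi n0.
(* [has_pi] is repeated under the quantifier because [mix_dist] is known to be measurable only on
   that set. *)
rewrite (_ : [set w | _] = [set w | has_pi R (G ^~ w)] `&`
   [set w | forall t : nat, t%:R < c -> has_pi R (G ^~ w) /\ eps < mix_dist R (G ^~ w) 0 t%:Z]).
  apply: measurableI => //; apply: measurable_forall => t; apply: measurable_imply => _.
  by have := measurable_mix_dist 0 t%:Z mH (measurable_itv `]eps, +oo[);
    congr measurable; apply/seteqP; split=> w /= [? ]; rewrite in_itv/= andbT.
apply/seteqP; split=> w /= [pi H]; split=> //.
  by move=> t tc; split=> //; move/tmix0_geP : H; exact.
by apply/tmix0_geP => t /H[].
Qed.

End Measurability.

(** * Probability estimates for random graphs *)

Section RandomGraphs.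
Context d (T : measurableType d) (R : realType) (P : probability T R).

Lemma union_bound (I : eqType) (s : seq I) (A : I -> set T) (B : set T) (c : R) :
  measurable B -> (forall i, i \in s -> measurable (A i)) ->
  (forall w, B w -> exists2 i, i \in s & A i w) ->
  (forall i, i \in s -> P (A i) <= c%:E)%E -> (P B <= ((size s)%:R * c)%:E)%E.
Proof.
move=> mB; elim: s B mB => [|i s IH] B mB mA BA Ac.
  rewrite mul0r (_ : B = set0) ?measure0//.
  by apply/seteqP; split=> w // /BA[].
have mAi : measurable (A i) by apply: mA; rewrite mem_head.
have mBi : measurable (B `\` A i) by exact: measurableD.
(* Peel off [A i]; the remaining events still cover the rest of [B]. *)
apply: (@le_trans _ _ (P (A i `|` (B `\` A i)))).
  apply: le_measure; rewrite ?inE//; first exact: measurableU.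
  by move=> w Bw; have [|] := pselect (A i w); [left|right].
apply: (le_trans (measureU2 _ _ _)) => //.
have -> : (size (i :: s))%:R * c = c + (size s)%:R * c by rewrite /= -natr1 mulrDl mul1r addrC.
rewrite EFinD leeD//; first by apply: Ac; rewrite mem_head.
apply: IH => // [j js|w [Bw nAi]|j js].
- by apply: mA; rewrite in_cons js orbT.
- by have [j] := BA w Bw; rewrite in_cons => /orP[/eqP -> //|js] Aj; exists j.
- by apply: Ac; rewrite in_cons js orbT.
Qed.

Context (n : nat) (p : R).

Lemma erdos_renyi_all (g : T -> graph n) (J : seq {set 'I_n}) :
  erdos_renyi P p g -> uniq J -> {subset J <= vertex_pairs n} ->
  measurable (\bigcap_(e in [set` J]) [set w | e \in val (g w)]) /\
  P (\bigcap_(e in [set` J]) [set w | e \in val (g w)]) = (p ^+ size J)%:E.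
Proof.
move=> [_ gp [mg indep]] uJ JV; split.
  by apply: fin_bigcap_measurable => // e /JV; exact: mg.
rewrite indep//; rewrite big_seq (eq_bigr (fun=> p%:E)) => [|e /JV]; last exact: gp.
by rewrite -big_seq prodEFin big_const_seq count_predT iter_mulr_1.
Qed.

(** A vertex of degree at least [K] is the centre of a star with [K] leaves. Each such star is
    present with probability [p ^+ K], and a union bound over the leaf sets [S] concludes. *)
Lemma deg_tail (g : T -> graph n) K x : erdos_renyi P p g -> 0 <= p ->
  (P [set w | (K <= deg (g w) x)%N] <= ('C(n, K)%:R * p ^+ K)%:E)%E.
Proof.
move=> er p0.
pose s := enum [set S : {set 'I_n} | (#|S| == K) && (x \notin S)]%SET.
pose star (S : {set 'I_n}) := [seq [set x; y]%SET | y <- enum S].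
pose A S := \bigcap_(e in [set` star S]) [set w | e \in val (g w)].
have sP S : S \in s -> measurable (A S) /\ P (A S) = (p ^+ K)%:E.
  rewrite mem_enum inE => /andP[/eqP <- xS].
  have -> : #|S| = size (star S) by rewrite size_map cardE.
  apply: erdos_renyi_all => // [|e /mapP[y]].
    (* Distinct leaves give distinct edges since the centre [x] is not in [S]. *)
    rewrite map_inj_in_uniq ?enum_uniq// => y z; rewrite !mem_enum => yS zS yz.
    have : y \in [set x; z]%SET by rewrite -yz !inE eqxx orbT.
    by rewrite !inE => /orP[/eqP yx|/eqP//]; rewrite -yx yS in xS.
  rewrite mem_enum => yS ->; rewrite inE cards2.
  by suff -> : x != y by []; apply: contraNneq xS => ->.
apply: (@le_trans _ _ ((size s)%:R * p ^+ K)%:E).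
  apply: (@union_bound _ s A).
  - by have [mg _ _] := er; exact: (mg [set h | (K <= deg h x)%N]).
  - by move=> S /sP[].
  - move=> w /= /card_geqP[l [ul lK ldeg]]; exists [set y in l]%SET.
      rewrite mem_enum inE cardsE; apply/andP; split.
        by rewrite -lK; apply/eqP/card_uniqP.
      by rewrite inE; apply/negP => /ldeg; rewrite inE adj_irr.
    by move=> e /mapP[y]; rewrite mem_enum inE => /ldeg; rewrite inE => ? ->.
  - by move=> S /sP[_ ->].
rewrite lee_fin ler_wpM2r ?exprn_ge0// ler_nat -cardE -[n in 'C(n, _)]card_ord -card_draws.
by apply/subset_leq_card/fintype.subsetP => S; rewrite !inE => /andP[].
Qed.

Lemma complete_prob (g : T -> graph n) : erdos_renyi P p g ->
  P [set w | complete (g w)] = (p ^+ #|vertex_pairs n|)%:E.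
Proof.
move=> er; have sub : {subset enum (vertex_pairs n) <= vertex_pairs n}.
  by move=> e; rewrite mem_enum.
rewrite cardE; have [_ <-] := erdos_renyi_all er (enum_uniq _) sub.
congr (P _); apply/seteqP; split=> w /=.
  by move=> gc e /= eV; rewrite gc; exact: sub.
move=> H; apply/eqP; rewrite finset.eqEsubset (valP (g w))/=.
by apply/fintype.subsetP => e eV; apply: H; rewrite /= mem_enum.
Qed.

Context (G : int -> T -> graph n).
Context (iidG : iid_erdos_renyi P p G) (p01 : 0 < p < 1).

Let notc := [set g : graph n | ~ complete g].

Lemma measurable_not_complete t : measurable [set w | ~ complete (G t w)].
Proof. by have [_ [mG _]] := iidG; exact: (mG t notc). Qed.

(** Each graph is complete with the same probability [q > 0], so [N] independent graphs all fail
    with probability [(1 - q) ^+ N], which tends to 0. *)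
Lemma no_complete_null (m : nat) :
  P [set w | forall k, ~ complete (G (- (m + k)%N%:Z) w)] = 0.
Proof.
have [er [mG indep]] := iidG; have /andP[p0 p1] := p01.
pose q := p ^+ #|vertex_pairs n|.
have q0 : 0 < q by rewrite exprn_gt0.
have q1 : q <= 1 by rewrite exprn_ile1// ltW.
have mN : measurable [set w | forall k, ~ complete (G (- (m + k)%N%:Z) w)].
  by apply: measurable_forall => k; exact: measurable_not_complete.
have bound N : (P [set w | forall k, ~ complete (G (- (m + k)%N%:Z) w)] <= ((1 - q) ^+ N)%:E)%E.
  pose J := [seq - (m + k)%N%:Z | k <- iota 0 N].
  have uJ : uniq J by rewrite map_inj_uniq ?iota_uniq// => a b; lia.
  have [mA PA] := indep (fun=> notc).
  have -> : ((1 - q) ^+ N)%:E = P (\bigcap_(t in [set` J]) (G t @^-1` notc)).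
    rewrite PA// (eq_bigr (fun=> (1 - q)%:E)) => [|t _].
      by rewrite prodEFin big_const_seq count_predT size_map size_iota iter_mulr_1.
    rewrite (_ : _ @^-1` _ = ~` [set w | complete (G t w)])//.
    rewrite probability_setC ?complete_prob//; exact: (mG t (@complete n)).
  apply: le_measure; rewrite ?inE//.
    by apply: fin_bigcap_measurable => // t _; exact: mA.
  by move=> w H t /= /mapP[k _ ->]; exact: H.
have fin : P [set w | forall k, ~ complete (G (- (m + k)%N%:Z) w)] \is a fin_num.
  exact: fin_num_measure.
apply/eqP; rewrite eq_le measure_ge0 andbT -(fineK fin) lee_fin.
have cvg0 : (fun N => (1 - q) ^+ N) @ \oo --> (0 : R).
  by apply: cvg_expr; rewrite ger0_norm; lra.
apply: (cvgr_to_ge cvg0); near=> N.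
by rewrite -lee_fin fineK.
Unshelve. all: by end_near.
Qed.

(** The event can fail only on the null set where complete graphs stop occurring in the past, or if
    some degree reaches [K] at a time from 1 to the horizon [m]. *)
Lemma mixing_event_ge (K m : nat) (c eps : R) : (0 < n)%N -> eps < 2^-1 ->
  (forall t : nat, t%:R < c -> (t <= m)%N /\ (K ^ t * K ^ t < n)%N) ->
  ((1 - (m * n)%:R * ('C(n, K)%:R * p ^+ K))%:E <=
   P [set w | has_pi R (G ^~ w) /\ (c%:E <= tmix0 (G ^~ w) eps)%E])%E.
Proof.
move=> n0 eps2 small; have [er [mG _]] := iidG; have /andP[p0 p1] := p01.
set E := [set w | _]; have mE : measurable E := measurable_event mG c eps n0.
pose N k := [set w | forall k', ~ complete (G (- (k + k')%N%:Z) w)].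
have mN k : measurable (N k).
  by apply: measurable_forall => k'; exact: measurable_not_complete.
pose D (ix : 'I_m * 'I_n) := [set w | (K <= deg (G ix.1.+1%:Z w) ix.2)%N].
have mD ix : measurable (D ix) by exact: (mG _ [set h | (K <= deg h ix.2)%N]).
have mUD : measurable [set w | exists ix, D ix w] by exact: measurable_exists.
have mUN : measurable (\bigcup_k N k) by exact: bigcupT_measurable.
have PN0 : P (\bigcup_k N k) = 0.
  apply: measure_negligible => //; apply: negligible_bigcup => k.
  by apply/negligibleP => //; exact: no_complete_null.
have PD : (P [set w | exists ix, D ix w] <= ((m * n)%:R * ('C(n, K)%:R * p ^+ K))%:E)%E.
  have -> : (m * n)%N = size (enum {: 'I_m * 'I_n}) by rewrite -cardE card_prod !card_ord.
  apply: (@union_bound _ _ D) => //.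
    by move=> w [ix Dix]; exists ix => //; rewrite mem_enum.
  by move=> ix _; apply: deg_tail => //; exact: ltW.
have sub : ~` E `<=` (\bigcup_k N k) `|` [set w | exists ix, D ix w].
  move=> w; apply: contra_notP => /not_orP[noN noD]; split.
    apply/has_pi_coalescing => // t; apply: complete_often_coalescing => k.
    have [//|no] := pselect (exists2 k', (k <= k')%N & complete (G (- k'%:Z) w)).
    case: noN; exists k => // k' gc; apply: no.
    by exists (k + k')%N => //; exact: leq_addr.
  apply/tmix0_geP => t /small[tm Kn]; apply: (lt_le_trans eps2).
  apply: mix_dist_ge_half Kn => i x /andP[i0 it]; rewrite ltnNge; apply/negP => Ki.
  have im : (i.-1 < m)%N by rewrite prednK// (leq_trans it).
  by apply: noD; exists (Ordinal im, x); rewrite /D/= prednK.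
have PE : (P (~` E) <= ((m * n)%:R * ('C(n, K)%:R * p ^+ K))%:E)%E.
  apply: (@le_trans _ _ (P (\bigcup_k N k `|` [set w | exists ix, D ix w]))).
    by apply: le_measure; rewrite ?inE//; [exact: measurableC|exact: measurableU].
  by have /le_trans := measureU2 P mUN mUD; apply; move: PD; rewrite -[X in (X <= _)%E]add0e -PN0.
rewrite -[E]setCK probability_setC; last exact: measurableC.
by rewrite EFinB leeB.
Qed.

End RandomGraphs.

(** * Real estimates for the tail bound and the time scale *)

Section Asymptotics.
Context (R : realType).

Lemma bin_expn_le (n K : nat) : ('C(n, K) * K`! <= n ^ K)%N.
Proof.
rewrite bin_ffact; elim: K => [|K IH]; first by rewrite ffactn0.
by rewrite ffactnSr expnSr leq_mul// leq_subr.
Qed.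

(* Chernoff bound for the binomial tail: [x^K / K! <= exp x] at [x = e n p]. *)
Lemma bin_expr_le (n K : nat) (p : R) : 0 <= p -> (0 < K)%N ->
  'C(n, K)%:R * p ^+ K <= expR (expR 1 * (n%:R * p) - K%:R).
Proof.
case: K => // K p0 _; set x := expR 1 * (n%:R * p).
have x0 : 0 <= x by rewrite !mulr_ge0// expR_ge0.
have : x ^+ K.+1 / K.+1`!%:R <= expR x.
  by apply: le_trans (expR_ge1Dxn K x0); rewrite lerDr.
have -> : x ^+ K.+1 = expR K.+1%:R * (n%:R ^+ K.+1 * p ^+ K.+1).
  by rewrite !exprMn -expRM_natr mul1r.
rewrite expRB ler_pdivlMr ?expR_gt0//; apply: le_trans.
rewrite mulrC -mulrA ler_pM2l ?expR_gt0// mulrAC ler_wpM2r ?exprn_ge0//.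
by rewrite ler_pdivlMr ?ltr0n ?fact_gt0// -natrM -natrX ler_nat bin_expn_le.
Qed.

(** With [L = ln n], [expR L >= 1 + L ^+ 2 / 2] gives [eta * L < n - 1]; the second bound is
    [n <= 2 * (n - 1)]. *)
Lemma edge_prob_lt1 (eta : R) (n : nat) : 0 < eta -> 2 * eta < ln n%:R ->
  0 < edge_prob eta n < 1 /\ n%:R * edge_prob eta n <= 2 * eta * ln n%:R.
Proof.
move=> eta0; rewrite /edge_prob; set L := ln _ => etaL.
have L0 : 0 < L by apply: lt_trans etaL; rewrite mulr_gt0.
(* By convention [ln] is 0 at nonpositive arguments, so a positive logarithm forces [n > 0]. *)
have n0 : 0 < n%:R :> R.
  by rewrite ltNge; apply/negP => /ln0 E; rewrite /L E ltxx in L0.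
have nE : n%:R = expR L by rewrite lnK.
have nL : 1 + L ^+ 2 / 2 <= n%:R by rewrite nE; exact: (expR_ge1Dxn 1 (ltW L0)).
have L2 : 2 * eta * L < L ^+ 2 by rewrite expr2 ltr_pM2r.
have n1 : 0 < n%:R - 1 :> R by have := mulr_gt0 eta0 L0; lra.
have n2 : 2 <= n%:R :> R by move: n1; rewrite subr_gt0 ltr1n ler_nat.
split; first by rewrite divr_gt0 ?mulr_gt0//= ltr_pdivrMr// mul1r; lra.
rewrite mulrC mulrAC ler_pdivrMr//.
have := ler_wpM2l (ltW (mulr_gt0 eta0 L0)) n2; lra.
Qed.

(** Here [K <= A * L + 1 <= L ^+ 2], so [K ^ (2 t)] is at most [expR (4 * t * ln L)], and the factor
    1/4 in the time bound makes this less than [expR L = n]. *)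
Lemma small_time_expn (A : R) (n t : nat) : 1 <= A -> 
  A + 1 <= ln n%:R -> expR 1 <= ln n%:R :> R ->
  t%:R < 4^-1 * (ln n%:R / ln (ln n%:R)) :> R ->
  let K := (Num.truncn (A * ln n%:R)).+1 in (t <= n)%N /\ (K ^ t * K ^ t < n)%N.
Proof.
set L := ln n%:R => A1 AL eL tL K.
have L0 : 0 < L by lra.
have n0 : 0 < n%:R :> R.
  by rewrite ltNge; apply/negP => /ln0 E; rewrite /L E ltxx in L0.
have nE : n%:R = expR L by rewrite lnK.
have l1 : 1 <= ln L by rewrite -(expRK 1) ler_ln ?posrE ?expR_gt0.
have tL4 : t%:R * ln L * 4 < L.
  by move: tL; rewrite mulrA ltr_pdivlMr; lra.
have t0 : 0 <= t%:R :> R by [].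
have KL : K%:R <= expR (2 * ln L).
  have AL0 : 0 <= A * L by rewrite mulr_ge0//; lra.
  have /andP[+ _] := truncn_itv AL0.
  rewrite expRM_natl lnK ?posrE// /K -natr1 expr2 => h.
  by have := ler_wpM2r (ltW L0) AL; lra.
split.
  rewrite -(ler_nat R) nE; have := expR_ge1Dx L; have := ler_wpM2l t0 l1; lra.
rewrite -expnD -(ltr_nat R) natrX nE; apply: (@le_lt_trans _ _ (expR (2 * ln L) ^+ (t + t))).
  by rewrite lerXn2r ?nnegrE ?expR_ge0.
rewrite -expRM_natl ltr_expR natrD; lra.
Qed.

End Asymptotics.

Theorem theorem5p13 (R : realType) (eta eps : R)
    (heta : 50 < eta) (heps0 : 0 < eps) (heps : eps < 2^-1) :
  exists c : R, 0 < c /\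
  forall (d : nat -> measure_display) (T : forall n, measurableType (d n))
         (P : forall n, probability (T n) R)
         (G : forall n, int -> T n -> graph n),
    (forall n, 0 < edge_prob eta n < 1 ->
       iid_erdos_renyi (P n) (edge_prob eta n) (G n)) ->
    P n [set w | has_pi R (fun t => G n t w) /\
           ((c * (ln n%:R / ln (ln n%:R)))%:E
              <= tmix0 (fun t => G n t w) eps)%E] @[n --> \oo] --> 1%E.
Proof.
exists 4^-1; split; first by rewrite invr_gt0.
move=> d T P G iid.
have eta0 : 0 < eta by lra.
(* The first term absorbs [expR 1 * (n * p)] in the Chernoff exponent; the 3 leaves a tail of
   [n ^ -3], which survives a union over [n ^ 2] pairs of time and vertex. *)
pose A : R := 2 * eta * expR 1 + 3.
have e0 := @expR_gt0 R 1.
have A3 : 3 <= A by rewrite lerDr !mulr_ge0// ltW.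
apply: (@squeeze_cvge _ _ _ _ (fun n => (1 - n%:R^-1)%:E) _ (fun=> 1%E)); last 2 first.
- apply: cvg_EFin; first exact: nearW.
  apply/cvgrPdist_le => e e_gt0; near=> n.
  have ne : e^-1 <= n%:R by near: n; exact: nbhs_infty_ger.
  rewrite subKr ger0_norm// -[e]invrK lef_pV2 ?posrE ?invr_gt0//.
  by apply: lt_le_trans ne; rewrite invr_gt0.
- exact: cvg_cst.
near=> n.
(* Lower bounds on [ln n]: the first two are required by [small_time_expn], the third by
   [edge_prob_lt1]. *)
pose B := Num.max (A + 1) (Num.max (expR 1) (2 * eta + 1)).
have nB : expR B <= n%:R by near: n; exact: nbhs_infty_ger.
have n0 : 0 < n%:R :> R by exact: lt_le_trans (expR_gt0 _) nB.
have : B <= ln n%:R by rewrite -(expRK B) ler_ln ?posrE ?expR_gt0.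
rewrite !ge_max => /and3P[AL eL etaL].
have [p01 npL] := @edge_prob_lt1 R eta n eta0 ltac:(lra).
have /andP[p0 p1] := p01; have n0' : (0 < n)%N by rewrite -(ltr_nat R).
have A1 : 1 <= A by lra.
have iidn := iid n p01.
pose K := (Num.truncn (A * ln n%:R)).+1.
have tail : 'C(n, K)%:R * edge_prob eta n ^+ K <= (n%:R ^+ 3)^-1.
  apply: (le_trans (bin_expr_le _ (ltW p0) _)) => //.
  rewrite -[X in _ <= (X ^+ 3)^-1]lnK ?posrE// -expRM_natl -expRN ler_expR.
  have : A * ln n%:R < K%:R by rewrite /K -truncn_lt_nat ?mulr_ge0//; lra.
  by have := ler_wpM2l (ltW e0) npL; rewrite /A; lra.
have [_ [mG _]] := iidn.
apply/andP; split; last by apply: probability_le1; exact: measurable_event.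
(* The horizon is [m = n], so the error is at most [n * n * n ^ -3 = 1 / n]. *)
apply: le_trans (mixing_event_ge iidn p01 n0' heps (fun t => @small_time_expn _ A n t A1 AL eL)).
rewrite lee_fin lerD2l lerN2.
apply: (le_trans (ler_wpM2l _ tail)) => //.
by rewrite natrM exprSr expr2 invfM mulrA divff ?mul1r// mulf_neq0// gt_eqF.
Unshelve. all: by end_near.
Qed.
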